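(* Let $p>3$ be a prime and $a\in\mathbb Z_p$ with $a\not\equiv0,-1,-2\pmod p$. Then $$\sum_{k=0}^{p-2}\binom ak\binom{-1-a}k\binom{2k}k\frac1{4^k(k+1)^3}\equiv-\frac2{a(a+1)}+\frac{(2a+1)^2}{a(a+1)}S_p(a)+\frac{4a^2(a+1)^2-a(a+1)+1}{a^3(a+1)}S_p(a+1)$$ $$\equiv-\frac2{a(a+1)}+\frac{4a^2(a+1)^2-a(a+1)+1}{a^2(a+1)^2}\sum_{k=0}^{p-2}\binom ak\binom{-1-a}k\binom{2k}k\frac1{4^k(k+1)}+\frac{2a(a+1)-1}{a^2(a+1)^2}S_p(a)\pmod{p^3}.$$
   Context: For a prime $p$, $\mathbb Z_p$ denotes the set of rational numbers whose denominator is not divisible by $p$, and congruences modulo powers of $p$ are between elements of $\mathbb Z_p$ (the difference divided by that power of $p$ lies in $\mathbb Z_p$). For rational $a$ and integer $k\ge0$, $\binom ak=a(a-1)\cdots(a-k+1)/k!$. Define $S_n(a)=\sum_{k=0}^{n-1}\binom ak\binom{-1-a}k\binom{2k}k\frac1{4^k}$ for $n\ge1$. *)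

(* Defs.v *)
From mathcomp Require Import all_boot all_order all_algebra.

Set Implicit Arguments.
Unset Strict Implicit.
Unset Printing Implicit Defensive.

Import Order.TTheory GRing.Theory Num.Theory.
Local Open Scope ring_scope.

(* The rational p-adic integers, i.e. the localization of the integers at the
   prime ideal (p), not its completion. *)
Definition Zloc (p : nat) : {pred rat} := [pred x : rat | ~~ (p %| `|denq x|)%N].

(* x = y modulo m, for m a power of p; on elements of Zloc p this is the
   congruence modulo the ideal generated by m. *)
Definition eqmod_Zloc (p m : nat) (x y : rat) : bool :=
  (x - y) / m%:R \in Zloc p.

Definition gbinom (a : rat) (k : nat) : rat :=
  (\prod_(i < k) (a - i%:R)) / (k`!)%:R.

Definition Ssum (n : nat) (a : rat) : rat :=
  \sum_(k < n) gbinom a k * gbinom (-1 - a) k * ('C(2 * k, k))%:R / 4 ^+ k.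

(* Main.v *)
Require Import Defs.
From mathcomp Require Import all_boot all_order all_algebra.
From mathcomp Require Import ring zify.
Import Order.TTheory GRing.Theory Num.Theory.
Local Open Scope ring_scope.

(** With [b = a (a + 1)], the summand [T k] satisfies
    [2 (k+1)^3 T (k+1) = (k (k+1) - b) (2k+1) T k], so [2 T k] and [2 k T k]
    have differences that are [T k] times polynomials in [1/(k+1)]; this
    expresses the sums weighted by [1/(k+1)^3] through those weighted by
    [1/(k+1)] and by [1].  Also
    [a T_a k + (a+1) T_{a+1} k - a T_a k / (k+1)] is the difference of
    [- 2 k^2 T_a k / (a+1-k)].  All boundary terms at [k = p-1] contain two
    generalized binomials and a central binomial, each divisible by [p]. *)

(** * Arithmetic of rationals integral at [p], and divisibility by [p] *)

Section LocalizedIntegers.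

Variables (p : nat) (p_prime : prime p).

(** The reduced denominator divides that of every other fraction for [x], so closure properties can
    be checked on unreduced fractions. *)
Lemma ZlocP (x : rat) :
  (exists n d : int, ~~ (p %| `|d|)%N /\ x = n%:~R / d%:~R)
  <-> x \in Zloc p.
Proof.
split; last first.
  by move=> xZ; exists (numq x), (denq x); rewrite divq_num_den.
move=> [n [d [pd ->]]]; rewrite inE; apply: contra pd => pdx.
by case: divqP pdx => [|k x' k0]; rewrite ?dvdn0 // abszM => ?; apply: dvdn_mull.
Qed.

Lemma Zloc_int (n : int) : n%:~R \in Zloc p.
Proof. by apply/ZlocP; exists n, 1; rewrite divr1 dvdn1 neq_ltn prime_gt1 ?orbT. Qed.

Lemma Zloc_nat (n : nat) : n%:R \in Zloc p.
Proof. exact: (Zloc_int n). Qed.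

Lemma intr_neq0_Zloc {d : int} : ~~ (p %| `|d|)%N -> d%:~R != 0 :> rat.
Proof. by rewrite intr_eq0; apply: contra => /eqP->; rewrite dvdn0. Qed.

Lemma Zloc_mul (x y : rat) : x \in Zloc p -> y \in Zloc p -> x * y \in Zloc p.
Proof.
move=> /ZlocP[n [d [pd ->]]] /ZlocP[m [e [pe ->]]]; apply/ZlocP.
exists (n * m), (d * e); rewrite abszM Euclid_dvdM // negb_or pd pe; split=> //.
by rewrite !intrM mulf_div.
Qed.

Lemma Zloc_add (x y : rat) : x \in Zloc p -> y \in Zloc p -> x + y \in Zloc p.
Proof.
move=> /ZlocP[n [d [pd ->]]] /ZlocP[m [e [pe ->]]]; apply/ZlocP.
exists (n * e + m * d), (d * e).
rewrite abszM Euclid_dvdM // negb_or pd pe; split=> //.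
by rewrite addf_div ?intr_neq0_Zloc // intrD !intrM.
Qed.

Lemma Zloc_opp (x : rat) : x \in Zloc p -> - x \in Zloc p.
Proof. by rewrite -mulN1r; apply: Zloc_mul; apply: (Zloc_int (-1)). Qed.

Lemma Zloc_sub (x y : rat) : x \in Zloc p -> y \in Zloc p -> x - y \in Zloc p.
Proof. by move=> xZ yZ; apply: Zloc_add => //; apply: Zloc_opp. Qed.

Lemma Zloc_exp (x : rat) (n : nat) : x \in Zloc p -> x ^+ n \in Zloc p.
Proof.
move=> xZ; elim: n => [|n IH]; first exact: (Zloc_nat 1).
by rewrite exprS Zloc_mul.
Qed.

Lemma Zloc_prod (I : finType) (P : pred I) (F : I -> rat) :
  (forall i, P i -> F i \in Zloc p) -> \prod_(i | P i) F i \in Zloc p.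
Proof.
by move=> FZ; apply: (big_ind (fun x => x \in Zloc p)) => //;
  [apply: (Zloc_nat 1)|apply: Zloc_mul].
Qed.

Lemma Zloc_inv (x : rat) :
  x \in Zloc p -> ~~ (x / p%:R \in Zloc p) -> x^-1 \in Zloc p.
Proof.
move=> /ZlocP[n [d [pd ->]]] xp; apply/ZlocP; exists d, n; rewrite invf_div.
split=> //; apply: contra xp => pn; apply/ZlocP.
have /dvdzP[m ->] : (p %| n)%Z by []; exists m, d.
have p0 : p%:R != 0 :> rat by rewrite pnatr_eq0 -lt0n prime_gt0.
by split=> //; rewrite intrM mulrAC mulfK.
Qed.

Lemma Zloc_inv_nat (n : nat) : ~~ (p %| n)%N -> n%:R^-1 \in Zloc p.
Proof. by move=> pn; apply/ZlocP; exists 1, n; rewrite mul1r. Qed.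

(** For [x = n / d], a Bezout relation [u d + v p = 1] makes [u] an inverse of [d] modulo [p], so
    [i] is the remainder of [n u]. *)
Lemma Zloc_residue (x : rat) : x \in Zloc p ->
  exists2 i : nat, (i < p)%N & (x - i%:R) / p%:R \in Zloc p.
Proof.
move=> /ZlocP[n [d [pd ->]]].
have p0 : (p : int) != 0 by rewrite -lt0n prime_gt0.
have /coprimezP[[u v] /= uv] : coprimez d p.
  by rewrite coprimezE coprime_sym prime_coprime.
have i0 := modz_ge0 (n * u) p0.
exists `|(n * u %% p)%Z|%N.
  by rewrite -ltz_nat gez0_abs // ltz_pmod // ltz_nat prime_gt0.
apply/ZlocP; exists (n * v + (n * u %/ p)%Z * d), d; split=> //.
have pQ : p%:~R != 0 :> rat by rewrite intr_eq0.
have dQ := intr_neq0_Zloc pd.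
rewrite [`|_|%N%:R]pmulrn gez0_abs //.
have nu : (n * u %% p)%Z%:~R
    = n%:~R * u%:~R - (n * u %/ p)%Z%:~R * p%:~R :> rat.
  by rewrite -!intrM -intrB {2}(divz_eq (n * u) p) addrAC subrr add0r.
have {}uv : v%:~R * p%:~R = 1 - u%:~R * d%:~R :> rat.
  by rewrite -!intrM -(intrB _ 1) -uv addrAC subrr add0r.
apply: (mulIf dQ); apply: (mulIf pQ); rewrite [p%:R]pmulrn mulrAC divfK //.
rewrite mulrBl !divfK // nu [(_ + _)%:~R]intrD !intrM.
by rewrite [RHS]mulrDl -[_ * v%:~R * _]mulrA uv; ring.
Qed.

(** The factors subtract every residue except [p - 1], that is [-1]; hence the residue of [x] is
    among them and its factor is divisible by [p]. *)
Lemma Zloc_falling (x : rat) : x \in Zloc p -> ~~ eqmod_Zloc p p x (-1) ->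
  (\prod_(i < p.-1) (x - i%:R)) / p%:R \in Zloc p.
Proof.
move=> xZ xN1; have [i ip xi] := Zloc_residue _ xZ.
have p0 : p%:R != 0 :> rat by rewrite pnatr_eq0 -lt0n prime_gt0.
have ip1 : (i < p.-1)%N.
  rewrite ltn_neqAle -ltnS prednK ?prime_gt0 // ip andbT.
  apply: contra xN1 => /eqP iE; rewrite /eqmod_Zloc.
  have -> : (x - -1) / p%:R = (x - i%:R) / p%:R + 1.
    apply: (mulIf p0); rewrite [RHS]mulrDl !divfK // mul1r.
    by rewrite iE -subn1 natrB ?prime_gt0 //; ring.
  exact: (Zloc_add _ _ xi (Zloc_nat 1)).
rewrite (bigD1 (Ordinal ip1)) //= mulrAC Zloc_mul // Zloc_prod // => j _.
by rewrite Zloc_sub // Zloc_nat.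
Qed.

Lemma prime_ndvd_fact (k : nat) : (k < p)%N -> ~~ (p %| k`!)%N.
Proof.
elim: k => [|k IH] kp; first by rewrite dvdn1 neq_ltn prime_gt1 ?orbT.
by rewrite factS Euclid_dvdM // negb_or gtnNdvd //= IH // ltnW.
Qed.

(** Since [p <= 2 (p - 1)], [p] divides the factorial of [2 (p - 1)], but it does not divide that of
    [p - 1]. *)
Lemma prime_dvd_central_bin : (p %| 'C(2 * p.-1, p.-1))%N.
Proof.
have p_gt1 := prime_gt1 p_prime.
have le : (p.-1 <= 2 * p.-1)%N by lia.
have ndvd : ~~ (p %| p.-1`!)%N by apply: prime_ndvd_fact; lia.
have : (p %| (2 * p.-1)`!)%N by apply: dvdn_fact; lia.
rewrite -(bin_fact le) (_ : 2 * p.-1 - p.-1 = p.-1)%N; last by lia.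
by rewrite !Euclid_dvdM // (negbTE ndvd) !orbF.
Qed.

End LocalizedIntegers.

(** Hypotheses are tried first, so that a quotient by [p ^ 3] known to be integral is taken whole
    and not split into a product with a non-integral inverse. *)
Ltac Zloc_closed p_prime :=
  repeat lazymatch goal with
  | H : is_true (?x \in Zloc _) |- is_true (?x \in Zloc _) => exact: H
  | |- is_true (1 \in _) => exact: (Zloc_nat _ p_prime 1)
  | |- is_true (_%:R \in _) => exact: (Zloc_nat _ p_prime)
  | |- is_true (_ - _ \in _) => apply: (Zloc_sub _ p_prime)
  | |- is_true (_ + _ \in _) => apply: (Zloc_add _ p_prime)
  | |- is_true (_ ^+ _ \in _) => apply: (Zloc_exp _ p_prime)
  | |- is_true (_ * _ \in _) => apply: (Zloc_mul _ p_prime)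
  end.

(** * The summand, its last value modulo [p ^ 3], and its recurrences *)

(** The two upper arguments are independent because relating [a] to [a + 1] goes through the mixed
    pair [a + 1], [-1 - a]. *)
Definition Sterm (x y : rat) (k : nat) : rat :=
  gbinom x k * gbinom y k * ('C(2 * k, k))%:R / 4 ^+ k.

(** Each falling product and the central binomial supply one factor [p]; the factorials and, as [p]
    is odd, the powers of 4 are units. *)
Lemma Zloc_Sterm (p : nat) (x y : rat) : prime p -> (2 < p)%N ->
  x \in Zloc p -> y \in Zloc p ->
  ~~ eqmod_Zloc p p x (-1) -> ~~ eqmod_Zloc p p y (-1) ->
  Sterm x y p.-1 / (p ^ 3)%:R \in Zloc p.
Proof.
move=> p_prime p_gt2 xZ yZ xN1 yN1.
have p0 : p%:R != 0 :> rat by rewrite pnatr_eq0 -lt0n prime_gt0.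
have pf : ~~ (p %| p.-1`!)%N by apply: prime_ndvd_fact => //; rewrite prednK // prime_gt0.
have f0 : (p.-1)`!%:R != 0 :> rat by rewrite pnatr_eq0 -lt0n fact_gt0.
have p4 : ~~ (p %| 4)%N.
  by rewrite (Euclid_dvdX 2 2 p_prime) andbT gtnNdvd.
have [m mE] : exists m, 'C(2 * p.-1, p.-1) = (m * p)%N.
  by apply/dvdnP; apply: prime_dvd_central_bin.
have -> : Sterm x y p.-1 / (p ^ 3)%:R =
    (\prod_(i < p.-1) (x - i%:R)) / p%:R * (p.-1)`!%:R^-1
    * ((\prod_(i < p.-1) (y - i%:R)) / p%:R * (p.-1)`!%:R^-1)
    * m%:R * (4%:R^-1) ^+ p.-1.
  rewrite /Sterm /gbinom mE natrM natrX exprVn.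
  by field; rewrite f0 p0 expf_neq0.
have Zfall z : z \in Zloc p -> ~~ eqmod_Zloc p p z (-1) ->
    (\prod_(i < p.-1) (z - i%:R)) / p%:R * (p.-1)`!%:R^-1 \in Zloc p.
  by move=> zZ zN1; rewrite Zloc_mul ?Zloc_falling ?Zloc_inv_nat.
apply: Zloc_mul => //; last by rewrite Zloc_exp ?Zloc_inv_nat.
apply: Zloc_mul => //; last exact: Zloc_nat.
by rewrite Zloc_mul ?Zfall.
Qed.

Lemma gbinom0 (x : rat) : gbinom x 0 = 1.
Proof. by rewrite /gbinom big_ord0 divr1. Qed.

Lemma gbinomS (x : rat) (k : nat) :
  gbinom x k.+1 = gbinom x k * (x - k%:R) / k.+1%:R.
Proof. by rewrite /gbinom big_ord_recr factS natrM invfM /=; ring. Qed.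

Lemma gbinom_shift (x : rat) (k : nat) :
  gbinom (x + 1) k * (x + 1 - k%:R) = gbinom x k * (x + 1).
Proof.
rewrite /gbinom mulrAC [RHS]mulrAC; congr (_ / _).
(* Splitting off the last factor of this product gives one side, the first factor the other. *)
transitivity (\prod_(i < k.+1) (x + 1 - i%:R)); first by rewrite big_ord_recr.
rewrite big_ord_recl subr0 mulrC.
by congr (_ * _); apply: eq_bigr => i _; rewrite lift0 -addn1 natrD; ring.
Qed.

Lemma central_binS (k : nat) :
  (k.+1 * 'C(2 * k.+1, k.+1) = 2 * k.*2.+1 * 'C(2 * k, k))%N.
Proof.
(* Both identities involve ['C((2 * k).+1, k)], which is then eliminated. *)
have diag := mul_bin_diag (2 * k.+1) k.
have down := mul_bin_down (2 * k).+1 k.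
rewrite (_ : (2 * k.+1).-1 = (2 * k).+1)%N in diag; last by lia.
rewrite /= (_ : (2 * k).+1 - k = k.+1)%N in down; last by lia.
by nia.
Qed.

Lemma Sterm0 (x y : rat) : Sterm x y 0 = 1.
Proof. by rewrite /Sterm !gbinom0 bin0 expr0 divr1 !mulr1. Qed.

Lemma SsumE (n : nat) (a : rat) : Ssum n a = \sum_(k < n) Sterm a (-1 - a) k.
Proof. by []. Qed.

Lemma StermS (x y : rat) (k : nat) :
  Sterm x y k.+1 =
  Sterm x y k * (x - k%:R) * (y - k%:R) * (2 * k%:R + 1) / (2 * k.+1%:R ^+ 3).
Proof.
have k0 : k.+1%:R != 0 :> rat by rewrite pnatr_eq0.
have cb : 'C(2 * k.+1, k.+1)%:R
    = 2 * (2 * k%:R + 1) / k.+1%:R * 'C(2 * k, k)%:R :> rat.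
  apply: (mulfI k0); rewrite -[LHS]natrM central_binS !natrM -addn1.
  rewrite -[k.*2.+1]addn1 !natrD -mul2n natrM.
  by field; rewrite nat1r.
rewrite /Sterm !gbinomS cb exprS; field.
by rewrite nat1r k0 expf_neq0.
Qed.

(** * Exact telescoping identities for the partial sums *)

(** With [T] the summand, the differences of [2 T k] and [2 k T k] both contain [1/(k+1)^2]. It
    cancels in the difference of [2 b T k - 2 (1 - 2 b) k T k]; summing gives the identity, with
    [- 2 b] coming from [T 0 = 1]. *)
Lemma Sterm_cube_sum (a : rat) (n : nat) :
  let b := a * (a + 1) in
  b ^+ 2 * (\sum_(k < n) Sterm a (-1 - a) k / k.+1%:R ^+ 3) =
  - (2 * b) + (4 * b ^+ 2 - b + 1) * (\sum_(k < n) Sterm a (-1 - a) k / k.+1%:R)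
  + (2 * b - 1) * (\sum_(k < n) Sterm a (-1 - a) k)
  + Sterm a (-1 - a) n * (2 * b - 2 * n%:R * (1 - 2 * b)).
Proof.
move=> b; elim: n => [|n IH]; first by rewrite !big_ord0 Sterm0; ring.
rewrite !big_ord_recr /= 3!mulrDr IH StermS /b -addn1 natrD.
by field; rewrite nat1r pnatr_eq0.
Qed.

Lemma Sterm_shift_sum (a : rat) (n : nat) :
  (a + 1) * (a * (\sum_(k < n) Sterm a (-1 - a) k)
             + (a + 1) * (\sum_(k < n) Sterm (a + 1) (-1 - (a + 1)) k)
             - a * (\sum_(k < n) Sterm a (-1 - a) k / k.+1%:R)) =
  - (2 * n%:R ^+ 2 * Sterm (a + 1) (-1 - a) n).
Proof.
(* Both families become multiples of the mixed term, which avoids dividing by [a + 1 - k]. *)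
have s1 k : (a + 1) * Sterm a (-1 - a) k
    = (a + 1 - k%:R) * Sterm (a + 1) (-1 - a) k.
  have g := gbinom_shift a k.
  transitivity (gbinom a k * (a + 1) * gbinom (-1 - a) k
                * 'C(2 * k, k)%:R / 4 ^+ k); first by rewrite /Sterm; ring.
  by rewrite -g /Sterm; ring.
have s2 k : (a + 1) * Sterm (a + 1) (-1 - (a + 1)) k
    = (a + 1 + k%:R) * Sterm (a + 1) (-1 - a) k.
  have := gbinom_shift (-1 - (a + 1)) k.
  rewrite (_ : -1 - (a + 1) + 1 = -1 - a); last by ring.
  move=> g; have {}g : (a + 1) * gbinom (-1 - (a + 1)) k
      = (a + 1 + k%:R) * gbinom (-1 - a) k.
    apply: oppr_inj; transitivity (gbinom (-1 - (a + 1)) k * (-1 - a)); first by ring.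
    by rewrite -g; ring.
  transitivity (gbinom (a + 1) k * ((a + 1) * gbinom (-1 - (a + 1)) k)
                * 'C(2 * k, k)%:R / 4 ^+ k); first by rewrite /Sterm; ring.
  by rewrite g /Sterm; ring.
elim: n => [|n IH]; first by rewrite !big_ord0; ring.
rewrite !big_ord_recr /= StermS.
transitivity (- (2 * n%:R ^+ 2 * Sterm (a + 1) (-1 - a) n)
  + a * ((a + 1) * Sterm a (-1 - a) n) * (1 - n.+1%:R^-1)
  + (a + 1) * ((a + 1) * Sterm (a + 1) (-1 - (a + 1)) n)).
  by rewrite -IH; ring.
rewrite s1 s2 -addn1 natrD.
by field; rewrite nat1r pnatr_eq0.
Qed.

(** * The congruences modulo [p ^ 3] *)

Theorem theorem10p1 (p : nat) (a : rat)
  (p_prime : prime p) (p_gt3 : (3 < p)%N) (aZ : a \in Zloc p)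
  (a_neq0 : ~~ eqmod_Zloc p p a 0)
  (a_neqN1 : ~~ eqmod_Zloc p p a (-1))
  (a_neqN2 : ~~ eqmod_Zloc p p a (-2)) :
  let lhs : rat :=
    \sum_(k < p.-1)
      gbinom a k * gbinom (-1 - a) k * ('C(2 * k, k))%:R
        / (4 ^+ k * (k.+1)%:R ^+ 3) in
  let mid : rat :=
    - (2 / (a * (a + 1)))
    + (2 * a + 1) ^+ 2 / (a * (a + 1)) * Ssum p a
    + (4 * a ^+ 2 * (a + 1) ^+ 2 - a * (a + 1) + 1) / (a ^+ 3 * (a + 1))
      * Ssum p (a + 1) in
  let rhs : rat :=
    - (2 / (a * (a + 1)))
    + (4 * a ^+ 2 * (a + 1) ^+ 2 - a * (a + 1) + 1) / (a ^+ 2 * (a + 1) ^+ 2)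
      * (\sum_(k < p.-1)
           gbinom a k * gbinom (-1 - a) k * ('C(2 * k, k))%:R
             / (4 ^+ k * (k.+1)%:R))
    + (2 * (a * (a + 1)) - 1) / (a ^+ 2 * (a + 1) ^+ 2) * Ssum p a in
  eqmod_Zloc p (p ^ 3) lhs mid /\ eqmod_Zloc p (p ^ 3) mid rhs.
Proof.
move=> lhs mid rhs.
have unit c : ~~ eqmod_Zloc p p a (- c%:R) -> a + c%:R != 0 /\ (a + c%:R)^-1 \in Zloc p.
  rewrite /eqmod_Zloc opprK => ac; split; last first.
    by apply: Zloc_inv => //; apply: Zloc_add => //; apply: Zloc_nat.
  by apply: contra ac => /eqP->; rewrite mul0r; apply: (Zloc_nat _ _ 0).
have [] := unit 0%N; first by rewrite oppr0.
rewrite addr0 => a0 aV.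
have [a1 a1V] := unit 1%N a_neqN1.
have p_gt2 : (2 < p)%N by apply: ltnW.
have pE : p = p.-1.+1 by rewrite prednK ?prime_gt0.
have natZ n : n%:R \in Zloc p by apply: Zloc_nat.
have bZ : -1 - a \in Zloc p.
  by rewrite Zloc_sub //; apply: (Zloc_int _ _ (-1)).
have a1Z : a + 1 \in Zloc p by exact: (Zloc_add _ _ _ _ aZ (natZ 1%N)).
have yZ : -1 - (a + 1) \in Zloc p.
  by rewrite Zloc_sub //; apply: (Zloc_int _ _ (-1)).
(* The next three facts keep each upper argument away from the residue [-1]; the reflection of [x]
   to [-1 - x] exchanges the residues 0 and [-1]. *)
have xN1 : ~~ eqmod_Zloc p p (a + 1) (-1).
  by apply: contra a_neqN2; rewrite /eqmod_Zloc (_ : a + 1 - -1 = a - -2) //; ring.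
have bN1 : ~~ eqmod_Zloc p p (-1 - a) (-1).
  apply: contra a_neq0; rewrite /eqmod_Zloc => /(Zloc_opp _ p_prime).
  by rewrite -mulNr (_ : - (-1 - a - -1) = a - 0) //; ring.
have yN1 : ~~ eqmod_Zloc p p (-1 - (a + 1)) (-1).
  apply: contra a_neqN1; rewrite /eqmod_Zloc => /(Zloc_opp _ p_prime).
  by rewrite -mulNr (_ : - (-1 - (a + 1) - -1) = a - -1) //; ring.
have T1 := Zloc_Sterm _ _ _ p_prime p_gt2 aZ bZ a_neqN1 bN1.
have T2 := Zloc_Sterm _ _ _ p_prime p_gt2 a1Z bZ xN1 bN1.
have T3 := Zloc_Sterm _ _ _ p_prime p_gt2 a1Z yZ xN1 yN1.
have lhsE : lhs = \sum_(k < p.-1) Sterm a (-1 - a) k / k.+1%:R ^+ 3.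
  by apply: eq_bigr => k _; rewrite /Sterm invfM mulrA.
have rhsE : \sum_(k < p.-1) gbinom a k * gbinom (-1 - a) k * 'C(2 * k, k)%:R
      / (4 ^+ k * k.+1%:R) = \sum_(k < p.-1) Sterm a (-1 - a) k / k.+1%:R.
  by apply: eq_bigr => k _; rewrite /Sterm invfM mulrA.
(* [Ssum p] runs one index further than the weighted sums, whence an extra boundary term. *)
have SE c : Ssum p c = \sum_(k < p.-1) Sterm c (-1 - c) k + Sterm c (-1 - c) p.-1.
  by rewrite [in LHS]pE SsumE big_ord_recr.
have cube := Sterm_cube_sum a p.-1; have shift := Sterm_shift_sum a p.-1.
rewrite /= -lhsE -rhsE in cube; rewrite -rhsE in shift.
rewrite /mid /rhs !SE; move: lhs T1 T2 T3 cube shift {lhsE rhsE SE mid rhs}.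
set A1 := \sum_(k < _) _ / _; set A0 := \sum_(k < _) _; set A0' := \sum_(k < _) _.
set T := Sterm _ _ _; set T' := Sterm _ (-1 - (a + 1)) _; set H := Sterm _ _ _.
move=> A3 TZ HZ T'Z cube shift.
set q : rat := p.-1%:R in cube shift.
have qZ : q \in Zloc p := natZ _.
have A3E : A3 = (- (2 * (a * (a + 1)))
    + (4 * (a * (a + 1)) ^+ 2 - a * (a + 1) + 1) * A1
    + (2 * (a * (a + 1)) - 1) * A0
    + T * (2 * (a * (a + 1)) - 2 * q * (1 - 2 * (a * (a + 1)))))
    / (a * (a + 1)) ^+ 2.
  by rewrite -cube; field; rewrite a0 a1.
have A0'E : A0' = a / (a + 1) * (A1 - A0) - 2 * q ^+ 2 * H / (a + 1) ^+ 2.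
  apply: (mulfI (expf_neq0 2 a1)).
  transitivity ((a + 1) * (a * A0 + (a + 1) * A0' - a * A1)
                + (a + 1) * a * (A1 - A0)); first by ring.
  by rewrite shift; field.
set R := - (2 / _) + _ * A1 + _; set M := - (2 / _) + _ + _.
set N := 4 * a ^+ 2 * _ - _ + 1 in R M *; set m := (p ^ 3)%:R in TZ HZ T'Z.
have m0 : m != 0 by rewrite pnatr_eq0 -lt0n expn_gt0 prime_gt0.
(* The left and middle members are each compared with the right one, in which only [A1], [A0] and
   [T] occur. *)
suff [A3R MR] : (A3 - R) / m \in Zloc p /\ (M - R) / m \in Zloc p.
  split=> //; rewrite /eqmod_Zloc -/m.
  have -> : (A3 - M) / m = (A3 - R) / m - (M - R) / m by ring.
  exact: Zloc_sub.
clearbody m q.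
have NZ : N \in Zloc p by rewrite /N; Zloc_closed p_prime.
split.
  (* [A1] and [A0] cancel, leaving the boundary term alone. *)
  have -> : (A3 - R) / m = T / m * (1 - 2 * q * (1 - 2 * (a * (a + 1))))
      * a^-1 ^+ 2 * (a + 1)^-1 ^+ 2.
    by rewrite A3E /R /N; field; rewrite m0 a0 a1.
  by Zloc_closed p_prime.
(* With [b = a (a + 1)], the coefficient of [A0] vanishes because [(2 a + 1)^2 = 4 b + 1] and
   [N = 4 b^2 - b + 1]; that of [A1] vanishes too. *)
have -> : (M - R) / m = T / m * ((2 * a + 1) ^+ 2 * a^-1 * (a + 1)^-1
       - (2 * (a * (a + 1)) - 1) * a^-1 ^+ 2 * (a + 1)^-1 ^+ 2)
    + N * a^-1 ^+ 3 * (a + 1)^-1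
      * (T' / m - 2 * q ^+ 2 * (a + 1)^-1 ^+ 2 * (H / m)).
  by rewrite /M /R A0'E /N; field; rewrite m0 a0 a1.
by Zloc_closed p_prime.
Qed.
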